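(* Let $G$ be a Polish space and let $T_i:G\to G$ be continuous for $i\in I$, where $I$ is a finite index set. If for one index $i\in I$ it holds that $\mathbb{P}(\xi=i)>0$ and $T_i(G)\subset K$, where $K\subset G$ is compact, then there exists an invariant measure for $\mathcal{P}$, i.e. a Borel probability measure $\pi$ on $G$ with $\pi\mathcal{P}=\pi$.
   Context: A Polish space here is a complete separable metric space. $\xi$ is an $I$-valued random variable on a probability space $(\Omega,\mathcal{F},\mathbb{P})$. The transition kernel is $p(x,A)=\mathbb{P}(T_\xi x\in A)$ for $x\in G$ and $A\subset G$ Borel; the associated Markov operator $\mathcal{P}$ acts on measures by $(\mu\mathcal{P})(A)=\int_G p(x,A)\,\mu(dx)$. *)

(* Defs.v *)
From HB Require Import structures.
From mathcomp Require Import all_boot all_order all_algebra.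
From mathcomp Require Import all_classical all_reals all_analysis.

Set Implicit Arguments.
Unset Strict Implicit.
Unset Printing Implicit Defensive.

Import Order.TTheory GRing.Theory Num.Theory.

Local Open Scope classical_set_scope.
Local Open Scope ring_scope.
Local Open Scope ereal_scope.

(* The library's completeness (and measurability) structures are pointed, so a
   [completeMetricType] is a nonempty complete metric space.  The distance is
   [mdist]; completeness is with respect to the uniformity it induces. *)
#[short(type="completeMetricType")]
HB.structure Definition CompleteMetric (R : numDomainType) :=
  { T of Complete T & Metric R T }.

Definition separable (T : topologicalType) : Prop :=
  exists2 D : set T, countable D & dense D.

Notation borel G := (g_sigma_algebraType (@open G)).

Section iterated_function_system.
Context {R : realType} {d dI : measure_display}.
Context {Omega : measurableType d} {I : measurableType dI}.
Context {P : probability Omega R} {G : completeMetricType R}.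
Variables (T : I -> G -> G) (xi : {RV P >-> I}).

Definition transition_kernel (x : G) (A : set G) : \bar R :=
  P [set w | A (T (xi w) x)].

Definition markov_operator (mu : {measure set (borel G) -> \bar R})
    (A : set (borel G)) : \bar R :=
  \int[mu]_x transition_kernel x A.

Definition invariant_measure (pi : probability (borel G) R) : Prop :=
  forall A : set (borel G), measurable A -> markov_operator pi A = pi A.

End iterated_function_system.

(* Main.v *)
Require Import Defs.
From HB Require Import structures.
From mathcomp Require Import all_boot all_order all_algebra.
From mathcomp Require Import all_classical all_reals all_analysis.
From mathcomp Require Import lra measurable_realfun.

Set Implicit Arguments.
Unset Strict Implicit.
Unset Printing Implicit Defensive.

Import Order.TTheory GRing.Theory Num.Theory.
Import numFieldNormedType.Exports.

Local Open Scope classical_set_scope.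
Local Open Scope ring_scope.

(** Write [p j] for the probability that [xi = j], and say that a set function
[m] is invariant when [m A = \sum_j p j * m (T j @^-1` A)].  This condition
makes sense for every set [A], measurable or not, which suggests to look first
for a finitely additive invariant probability on all subsets of [G], and to
make it countably additive only afterwards.

Finitely additive solution.  Start from a point mass, iterate the Markov
operator, take Cesaro averages, and pass to the limit along a free ultrafilter
on the integers.  No topology is involved, the limit exists on every subset,
and the telescoping of the averages makes it invariant
([invariant_additive_probability]).

Tightness.  A step that applies [T i] lands in [K], so after [n] steps the
chain is outside the images of [K] under words of length less than [n] only if
[T i] was not drawn, which has probability at most [(1 - p i) ^ n].  Invariance
alone turns this into [m (~` K_n) <= (1 - p i) ^+ n] for the compact union
[K_n] of these images ([additive_word_compactC], [invariant_tight]).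

Countable additivity.  Give an open set [U] the supremum of [m F] over the
closed subsets [F] of [U], and an arbitrary set the infimum over its open
supersets.  Tightness provides the compactness argument that makes this an
outer measure; open sets are Caratheodory measurable, and a Borel probability
[pi] results ([borel_extension]).

Invariance of [pi].  If [F] is closed in the open set [U], then
[m F = \sum_j p j * m (T j @^-1` F)], where [T j @^-1` F] is closed in
[T j @^-1` U] by continuity.  Hence [pi U <= \sum_j p j * pi (T j @^-1` U)],
that is, the value of [pi] on open sets is at most that of its image under the
Markov operator.  Two Borel probabilities compared in this way on all open sets
are equal ([eq_probability_open_le]). *)

(** * Finitely additive probabilities on all subsets *)

Record additive_probability {R : realType} {T : Type} (m : set T -> R) : Prop :=
{
  additive_ge0 : forall A, 0 <= m A ;
  additive_setT : m setT = 1 ;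
  additive_setU : forall A B, A `&` B = set0 -> m (A `|` B) = m A + m B
}.

Section additive_probability.
Context {R : realType} {T : Type} {m : set T -> R}.
Hypothesis mP : additive_probability m.

Lemma additive_set0 : m set0 = 0.
Proof.
have := additive_setU mP (setI0 set0); rewrite setU0 => /eqP.
by rewrite -[X in X == _]addr0 (inj_eq (addrI _)) eq_sym => /eqP.
Qed.

Lemma le_additive A B : A `<=` B -> m A <= m B.
Proof.
move=> AB; rewrite -(setDUK AB) (additive_setU mP) ?setDIK//.
by rewrite lerDl (additive_ge0 mP).
Qed.

Lemma additive_le1 A : m A <= 1.
Proof. by rewrite -(additive_setT mP); exact: le_additive. Qed.

Lemma additive_setU_le A B : m (A `|` B) <= m A + m B.
Proof.
have -> : A `|` B = A `|` (B `\` A) by rewrite setDE setUIr setUv setIT.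
by rewrite (additive_setU mP) ?setDIK// lerD2l le_additive.
Qed.

Lemma additive_bigsetU_le (A : nat -> set T) n :
  m (\bigcup_(k < n) A k) <= \sum_(k < n) m (A k).
Proof.
rewrite bigcup_mkord; elim: n => [|n IH].
  by rewrite !big_ord0 additive_set0.
by rewrite !big_ord_recr/= (le_trans (additive_setU_le _ _))// lerD2r.
Qed.

End additive_probability.

(** * Exhausting an open set by closed subsets *)

(** The closure does not leave [U]: the ball of radius [1 / (n + 1)] around a
point that it adds meets the eroded set, so that this point lies in a ball
contained in [U]. *)
Definition erosion {R : realType} {X : pseudoMetricType R} (U : set X) n :
    set X :=
  closure [set x | ball x n.+1%:R^-1 `<=` U].

Section erosion.
Context {R : realType} {X : pseudoMetricType R}.
Implicit Type U : set X.

Lemma closed_erosion U n : closed (erosion U n).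
Proof. exact: closed_closure. Qed.

Lemma erosion_sub U n : erosion U n `<=` U.
Proof.
move=> x /(_ (ball x n.+1%:R^-1)) []; first exact: nbhsx_ballx.
by move=> z [zU xz]; apply: zU; exact: ball_sym.
Qed.

Lemma erosion_nondecreasing U : nondecreasing_seq (erosion U).
Proof.
move=> m n mn; apply/subsetPset; apply: closureS => x /= xU.
apply: subset_trans xU; apply: le_ball.
by rewrite lef_pV2 ?posrE// ler_nat.
Qed.

(** The uniformity in [y] near [x] is what lets a compact subset of [U] be
absorbed by a single erosion. *)
Lemma near_erosion U x : open U -> U x ->
  \forall y \near x & n \near \oo, erosion U n y.
Proof.
move=> oU Ux.
have /nbhs_ballP[r /= r0 xrU] : nbhs x U by exact: open_nbhs_nbhs.
have r2 : 0 < r / 2 by rewrite divr_gt0.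
near=> y n; apply: subset_closure => /= z yz; apply: xrU.
rewrite [r]splitr; apply: (@ball_triangle _ _ y).
  by near: y; exact: nbhsx_ballx.
apply: le_ball yz; near: n.
have /cvgrPdist_le := @cvg_harmonic R; move=> /(_ _ r2).
apply: filterS => n; rewrite sub0r normrN; apply: le_trans; exact: ler_norm.
Unshelve. all: by end_near. Qed.

End erosion.

(** * From a tight additive probability to a Borel probability *)

Definition tight {R : realType} {X : topologicalType} (m : set X -> R) :=
  forall e : R, 0 < e -> exists2 K : set X, compact K & m (~` K) <= e.

Local Open Scope ereal_scope.

Definition inner_content {R : realType} {X : topologicalType} (m : set X -> R)
    (U : set X) : \bar R :=
  ereal_sup [set (m F)%:E | F in [set F | closed F /\ F `<=` U]].

Definition regular_outer {R : realType} {X : topologicalType} (m : set X -> R)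
    (A : set X) : \bar R :=
  ereal_inf [set inner_content m U | U in [set U | open U /\ A `<=` U]].

(** Normalizing a measure of total mass one leaves it unchanged but makes it a
[probability]. *)
Lemma probability_of_measure d (T : measurableType d) (R : realType)
    (nu : {measure set T -> \bar R}) : nu setT = 1 ->
  exists pi : probability T R, forall A, pi A = nu A.
Proof.
move=> nuT; exists (mnormalize nu (\d_point : probability T R)) => A.
by rewrite /= /mnormalize/= nuT onee_eq0/= invr1 mule1.
Qed.

Section regular_outer.
Context {R : realType} {G : completeMetricType R} {m : set G -> R}.
Hypotheses (mP : additive_probability m) (tm : tight m).
Notation inner := (inner_content m).
Notation outer := (regular_outer m).

Lemma le_inner_closed F U : closed F -> F `<=` U -> (m F)%:E <= inner U.
Proof. by move=> cF FU; apply: ereal_sup_ubound; exists F. Qed.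

Lemma inner_le U b : (forall F, closed F -> F `<=` U -> (m F)%:E <= b) ->
  inner U <= b.
Proof. by move=> h; apply: ge_ereal_sup => _ [F [cF FU] <-]; exact: h. Qed.

Lemma inner_ge0 U : 0 <= inner U.
Proof.
rewrite (le_trans _ (@le_inner_closed set0 U closed0 (@sub0set _ _)))//.
by rewrite lee_fin (additive_ge0 mP).
Qed.

Lemma inner_le1 U : inner U <= 1.
Proof. by apply: inner_le => F _ _; rewrite lee_fin (additive_le1 mP). Qed.

Lemma le_inner U V : U `<=` V -> inner U <= inner V.
Proof.
by move=> UV; apply: inner_le => F cF FU; apply: le_inner_closed => // x /FU/UV.
Qed.

Lemma innerT : inner setT = 1.
Proof.
apply/eqP; rewrite eq_le inner_le1/= -[leLHS](congr1 EFin (additive_setT mP)).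
by apply: le_inner_closed => //; exact: closedT.
Qed.

(** Up to [e], a closed set [F] inside the union is the compact set [K `&` F].
The erosions of the [U k] grow with their index and their interiors cover the
[U k], so that finitely many of them, all taken at the same index [N], cover
[K `&` F]; finite subadditivity of [m] then applies. *)
Lemma inner_sigma_subadditive (U : nat -> set G) : (forall n, open (U n)) ->
  inner (\bigcup_n U n) <= \sum_(n <oo) inner (U n).
Proof.
move=> oU; apply: inner_le => F cF FU; apply/lee_addgt0Pr => e e0.
have [K cK mK] := tm e0.
have [N _ cover] : \forall N \near \oo, K `&` F `<=`
    [set x | exists2 k, (k < N)%N & erosion (U k) N x].
  apply: (proj1 (compact_near_coveringP _) (compact_closedI cK cF)) => x.
  move=> [_ /FU[k _ Ukx]].
  have [[A B] /= [xA NB] AB] := near_erosion (oU k) Ukx.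
  exists (A, B `&` [set N | (k < N)%N]) => /=.
    by split=> //; apply: filterI => //; exact: nbhs_infty_gt.
  by move=> [y N] [/= Ay [BN kN]]; exists k => //; exact: (AB (y, N)).
have {}cover := cover N (leqnn N).
have FE : F `<=` ~` K `|` \bigcup_(k < N) erosion (U k) N.
  move=> x Fx; have [Kx|] := pselect (K x); last by left.
  by have [k kN xk] := cover x (conj Kx Fx); right; exists k.
apply: (@le_trans _ _ (\sum_(k < N) inner (U k) + e%:E)); last first.
  rewrite leeD2r// -(big_mkord xpredT (fun k => inner (U k))).
  by apply: nneseries_lim_ge => k _ _; exact: inner_ge0.
apply: (@le_trans _ _ (\sum_(k < N) m (erosion (U k) N) + e)%R%:E).
  rewrite lee_fin (le_trans (le_additive mP FE))//.
  rewrite (le_trans (additive_setU_le mP _ _))//.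
  by rewrite addrC lerD// additive_bigsetU_le.
rewrite EFinD leeD2r// -sumEFin; apply: lee_sum => k _.
by apply: le_inner_closed; [exact: closed_erosion|exact: erosion_sub].
Qed.

Lemma outer_le A U : open U -> A `<=` U -> outer A <= inner U.
Proof. by move=> oU AU; apply: ereal_inf_lbound; exists U. Qed.

Lemma outer_open U : open U -> outer U = inner U.
Proof.
move=> oU; apply/eqP; rewrite eq_le outer_le//=.
by apply: le_ereal_inf_tmp => _ [V [_ UV] <-]; exact: le_inner.
Qed.

Lemma outer_ge0 A : 0 <= outer A.
Proof. by apply: le_ereal_inf_tmp => _ [U _ <-]; exact: inner_ge0. Qed.

Lemma outer_fin_num A : outer A \is a fin_num.
Proof.
rewrite ge0_fin_numE ?outer_ge0//.
rewrite (le_lt_trans (outer_le openT (@subsetT _ _)))//.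
by rewrite innerT ltry.
Qed.

Lemma outer0 : outer set0 = 0.
Proof.
rewrite outer_open; last exact: open0.
apply/eqP; rewrite eq_le inner_ge0 andbT; apply: inner_le => F _.
by rewrite subset0 => ->; rewrite (additive_set0 mP).
Qed.

Lemma le_outer : {homo outer : A B / A `<=` B >-> A <= B}.
Proof.
move=> A B AB; apply: le_ereal_inf_tmp => _ [V [oV BV] <-].
by apply: outer_le => // x /AB/BV.
Qed.

Lemma outer_sigma_subadditive : sigma_subadditive outer.
Proof.
move=> A; apply/lee_addgt0Pr => e e0.
have /choice[U UP] n : exists U : set G, [/\ open U, A n `<=` U &
    inner U <= outer (A n) + (e / (2 ^ n.+1)%:R)%:E].
  have en : (0 < e / (2 ^ n.+1)%:R)%R by rewrite divr_gt0// ltr0n expn_gt0.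
  have [_ [U [oU AU] <-] /ltW UA] :=
    lb_ereal_inf_adherent en (outer_fin_num (A n)).
  by exists U.
have oU n : open (U n) by have [] := UP n.
apply: (@le_trans _ _ (inner (\bigcup_n U n))).
  apply: outer_le; first exact: bigcup_open.
  by apply: subset_bigcup => n _; have [] := UP n.
apply: (le_trans (inner_sigma_subadditive oU)).
apply: le_trans (epsilon_trick _ (fun n => outer_ge0 (A n)) (ltW e0)).
by apply: lee_nneseries => n _ *; [exact: inner_ge0|have [] := UP n].
Qed.

(** If [V] is an open superset of [X], choose [F] closed in [V `&` U] and then
[F'] closed in [V `&` ~` F], which is an open superset of [X `&` ~` U].  Being
disjoint and closed in [V], the two sets satisfy
[m F + m F' = m (F `|` F') <= inner V]; take suprema over [F'], then over
[F]. *)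
Lemma outer_open_split U X : open U ->
  outer (X `&` U) + outer (X `&` ~` U) <= outer X.
Proof.
move=> oU; apply: le_ereal_inf_tmp => _ [V [oV XV] <-].
apply: (@le_trans _ _ (inner (V `&` U) + outer (X `&` ~` U))).
  by rewrite leeD2r// outer_le//; [exact: openI|exact: setSI].
rewrite -leeBrDr ?outer_fin_num//; apply: inner_le => F cF FVU.
rewrite leeBrDr ?outer_fin_num// addeC -leeBrDr//.
apply: (@le_trans _ _ (inner (V `&` ~` F))).
  apply: outer_le; first by apply: openI => //; exact: closed_openC.
  by move=> x [/XV Vx nUx]; split=> // /FVU[].
apply: inner_le => F' cF' F'VF; rewrite leeBrDr// -EFinD -(additive_setU mP).
  apply: le_inner_closed; first exact: closedU.
  by move=> x [/F'VF[]//|/FVU[]].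
by apply/seteqP; split=> // x [/F'VF[]].
Qed.

Lemma borel_extension : exists pi : probability (borel G) R,
  forall U : set G, open U -> pi U = inner U.
Proof.
pose mu : {outer_measure set G -> \bar R} := HB.pack outer
  (isOuterMeasure.Build R G outer outer0 outer_ge0 le_outer
     outer_sigma_subadditive).
have borel_cara : <<s @open G >> `<=` mu.-caratheodory.
  apply: smallest_sub.
    exact: (@sigma_algebra_measurable _ (caratheodory_type mu)).
  move=> U oU; apply: le_caratheodory_measurable => X; exact: outer_open_split.
have outer_sigma_additive :
    semi_sigma_additive (outer : set (borel G) -> \bar R).
  move=> A mA tA mUA.
  apply: (@caratheodory_measure_sigma_additive _ _ mu) => //.
    by move=> n; apply: borel_cara; exact: mA.
  by apply: borel_cara.
pose nu : {measure set (borel G) -> \bar R} :=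
  HB.pack (outer : set (borel G) -> \bar R)
  (isMeasure.Build _ (borel G) R (outer : set (borel G) -> \bar R)
    outer0 outer_ge0 outer_sigma_additive).
have nuT : nu setT = 1 by rewrite /= outer_open ?innerT//; exact: openT.
have nuE U : open U -> nu U = inner U by exact: outer_open.
have [pi piE] := probability_of_measure nuT.
by exists pi => U oU; rewrite piE nuE.
Qed.

End regular_outer.

(** * Comparing Borel probabilities on open sets *)

Section borel_probability.
Context {R : realType} {G : completeMetricType R}.
Implicit Types mu nu : probability (borel G) R.

Lemma open_borel (U : set (borel G)) : open (U : set G) -> measurable U.
Proof. exact: sub_sigma_algebra. Qed.

Lemma closed_borel (F : set (borel G)) : closed (F : set G) -> measurable F.
Proof.
move=> cF; rewrite -(setCK F); apply: measurableC; apply: open_borel.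
exact: closed_openC.
Qed.

Lemma erosion_cvg mu (U : set G) : open U ->
  mu (erosion U n) @[n --> \oo] --> mu U.
Proof.
move=> oU; have {2}-> : U = \bigcup_n erosion U n.
  apply/seteqP; split=> [x Ux|x [n _ /erosion_sub//]].
  have [[A B] /= [xA [n _ nB]] AB] := near_erosion oU Ux.
  by exists n => //; apply: (AB (x, n)); split=> /=;
    [exact: nbhs_singleton|exact: nB n (leqnn n)].
apply: nondecreasing_cvg_mu => [n||]; last exact: erosion_nondecreasing.
  by apply: closed_borel; exact: closed_erosion.
by apply: bigcupT_measurable => n; apply: closed_borel; exact: closed_erosion.
Qed.

(** Complementation reverses the inequality on closed sets.  Every open set is
an increasing union of closed sets, so that the reversed inequality passes to
open sets, which form a generating pi-system. *)
Lemma eq_probability_open_le mu nu :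
  (forall U : set G, open U -> mu U <= nu U) ->
  forall A, measurable A -> mu A = nu A.
Proof.
move=> munu; have closed_le (F : set G) : closed F -> nu F <= mu F.
  move=> cF; have oF : open (~` F) by exact: closed_openC.
  have FE (pi : probability (borel G) R) : pi F = 1 - pi (~` F).
    by rewrite -probability_setC ?setCK//; exact: open_borel.
  by rewrite !FE; apply: leeB => //; exact: munu.
apply: (@measure_unique _ _ (borel G) (@open G) (fun=> setT)) => //.
- by move=> A B; exact: openI.
- by move=> _; exact: openT.
- by apply/seteqP; split=> // x _; exists 0%N.
- move=> U oU; apply/eqP; rewrite eq_le; apply/andP; split; first exact: munu.
  refine (lee_cvg_to (erosion_cvg (mu:=nu) oU) (erosion_cvg (mu:=mu) oU) _).
  by apply: nearW => n; apply: closed_le; exact: closed_erosion.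
- by move=> _; exact: le_lt_trans (probability_le1 mu measurableT) (ltry _).
Qed.

End borel_probability.

Local Close Scope ereal_scope.

(** * An invariant finitely additive probability *)

Definition push_additive {R : realType} {X I : Type} (s : seq I) (p : I -> R)
    (T : I -> X -> X) (m : set X -> R) (A : set X) : R :=
  \sum_(j <- s) p j * m (T j @^-1` A).

Definition cesaro_average {R : realType} {X : Type} (q : nat -> set X -> R) n
    (A : set X) : R :=
  n.+1%:R^-1 * \sum_(k < n.+1) q k A.

Lemma additive_probability_point {R : realType} {X : Type} (x : X) :
  additive_probability (fun A => \1_A x : R).
Proof.
split=> [A||A B AB]; [by rewrite indicE|by rewrite indicT|].
rewrite !indicE in_setU; have [xA|] := boolP (x \in A); last by rewrite add0r.
have [xB|] := boolP (x \in B); last by rewrite addr0.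
have := mem_set (conj (set_mem xA) (set_mem xB) : (A `&` B) x).
by rewrite AB in_set0.
Qed.

Lemma additive_probability_cesaro {R : realType} {X : Type}
    (q : nat -> set X -> R) n :
  (forall k, additive_probability (q k)) ->
  additive_probability (cesaro_average q n).
Proof.
move=> qP; split=> [A||A B AB]; rewrite /cesaro_average.
- by rewrite mulr_ge0// sumr_ge0// => k _; exact: additive_ge0 (qP k) A.
- under eq_bigr do rewrite (additive_setT (qP _)).
  by rewrite sumr_const card_ord mulVf// pnatr_eq0.
- under eq_bigr do rewrite (additive_setU (qP _) AB).
  by rewrite big_split mulrDr.
Qed.

(** A pointwise limit along an ultrafilter exists because each sequence of
values stays in the compact interval [[0, 1]]. *)
Lemma additive_probability_ultralimit {R : realType} {X : Type}
    (F : set_system nat) (q : nat -> set X -> R) : UltraFilter F ->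
  (forall n, additive_probability (q n)) ->
  exists2 m : set X -> R, additive_probability m &
    forall A, q n A @[n --> F] --> m A.
Proof.
move=> UF qP.
have /choice[m qm] A : exists l : R, q n A @[n --> F] --> l.
  have [|l [_ ql]] := @segment_compact R 0 1 (q n A @[n --> F]).
    apply: nearW => n /=.
    by rewrite in_itv/= (additive_ge0 (qP n)) additive_le1.
  (* a cluster point of an ultrafilter is a limit *)
  exists l => B lB.
  have [//|FnB] := in_ultra_setVsetC ((fun n => q n A) @^-1` B) UF.
  by have [y []] := ql (~` B) B FnB lB.
exists m => //; split=> [A||A B AB].
- refine (ler_cvg_to (cvg_cst (0 : R)) (qm A) _).
  by apply: nearW => n; exact: additive_ge0.
- apply: (cvg_unique _ (qm setT)) => //=.
  by under eq_fun do rewrite (additive_setT (qP _)); exact: cvg_cst.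
- apply: (cvg_unique _ (qm (A `|` B))) => //=.
  under eq_fun do rewrite (additive_setU (qP _) AB).
  exact: cvgD.
Qed.

Section push_additive.
Context {R : realType} {X : Type} {I : choiceType} (s : seq I) (p : I -> R).
Variable T : I -> X -> X.
Hypotheses (p_ge0 : forall j, 0 <= p j) (p_sum : \sum_(j <- s) p j = 1).
Notation push := (push_additive s p T).

Lemma additive_probability_push m :
  additive_probability m -> additive_probability (push m).
Proof.
move=> mP; split=> [A||A B AB]; rewrite /push_additive.
- by apply: sumr_ge0 => j _; rewrite mulr_ge0// (additive_ge0 mP).
- by under eq_bigr do rewrite preimage_setT (additive_setT mP) mulr1.
- rewrite -big_split; apply: eq_bigr => j _.
  rewrite preimage_setU (additive_setU mP) ?mulrDr//.
  by rewrite -preimage_setI AB preimage_set0.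
Qed.

(** Applying [push] to the [n]th Cesaro average of the orbit of a point mass
changes it by at most [1 / (n + 1)] on every set, which vanishes in the
limit. *)
Lemma invariant_additive_probability (x : X) :
  exists2 m : set X -> R, additive_probability m & forall A, push m A = m A.
Proof.
pose q k := iter k push (fun A => \1_A x).
have qP k : additive_probability (q k).
  by elim: k => [|k IH]; [exact: additive_probability_point|
    exact: additive_probability_push].
have [F [UF oF]] := @ultraFilterLemma nat \oo _.
have [m mP qm] := additive_probability_ultralimit UF
  (fun n => additive_probability_cesaro n qP).
exists m => // A.
have telescope n : push (cesaro_average q n) A - cesaro_average q n A =
    n.+1%:R^-1 * (q n.+1 A - q 0%N A).
  rewrite /push_additive /cesaro_average.
  under eq_bigr do rewrite mulrCA mulr_sumr.
  rewrite -mulr_sumr -mulrBr exchange_big/=; congr (_ * _).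
  have := telescope_sumr (fun k => q k A) (leq0n n.+1).
  by rewrite big_mkord /= sumrB => <-.
have diff0 :
    push (cesaro_average q n) A - cesaro_average q n A @[n --> F] --> 0.
  apply: (cvg_trans (cvg_app _ oF)).
  under eq_fun do rewrite telescope.
  apply: (squeeze_cvgr _ (f := fun n => - harmonic n) (h := harmonic)).
  - apply: nearW => n; rewrite -ler_norml normrM ger0_norm ?invr_ge0//.
    rewrite ler_piMr ?invr_ge0// ler_norml.
    have := additive_le1 (qP n.+1) A; have := additive_ge0 (qP n.+1) A.
    have := additive_le1 (qP 0%N) A; have := additive_ge0 (qP 0%N) A.
    by lra.
  - by rewrite -oppr0; apply: cvgN; exact: cvg_harmonic.
  - exact: cvg_harmonic.
apply/eqP; rewrite -subr_eq0; apply/eqP; apply: (cvg_unique _ _ diff0) => //=.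
apply: cvgB => //; rewrite /push_additive.
apply: cvg_big => [|j _]; first exact: add_continuous.
by apply: cvgMr; exact: qm.
Qed.

End push_additive.

(** * Tightness from a map with relatively compact range *)

Section tightness.
Context {R : realType} {X : topologicalType} {I : choiceType}.
Context {s : seq I} {p : I -> R} {T : I -> X -> X}.
Hypotheses (us : uniq s) (p_ge0 : forall j, 0 <= p j).
Hypothesis p_sum : \sum_(j <- s) p j = 1.
Hypothesis contT : forall j, continuous (T j).
Context {i : I} {K : set X}.
Hypotheses (si : i \in s) (p_gt0 : 0 < p i).
Hypotheses (cK : compact K) (TK : range (T i) `<=` K).

(** Images of [K] under the words of length less than [n]; starting from the
empty set at [n = 0] lets the bound [(1 - p i) ^+ n] begin with the trivial
estimate by [1]. *)
Fixpoint word_compact n : set X :=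
  if n is n'.+1
  then K `|` \big[setU/set0]_(j <- s) (T j @` word_compact n')
  else set0.

Lemma compact_word_compact n : compact (word_compact n).
Proof.
elim: n => [|n IH] /=; first exact: compact0.
apply: compactU => //; apply: bigsetU_compact => j _.
by apply: continuous_compact => //; exact: continuous_subspaceT.
Qed.

(** By invariance, the mass outside [word_compact n.+1] is a mixture over the
first map.  The term of [T i] vanishes because [T i] sends every point into
[K], and each other [T j] sends [word_compact n] into [word_compact n.+1]; the
remaining weights add up to [1 - p i]. *)
Lemma additive_word_compactC m n : additive_probability m ->
  (forall A, push_additive s p T m A = m A) ->
  m (~` word_compact n) <= (1 - p i) ^+ n.
Proof.
move=> mP minv; elim: n => [|n IH]; first by rewrite additive_le1.
have rest : \sum_(j <- s | j != i) p j = 1 - p i.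
  by rewrite -p_sum [in RHS](bigD1_seq i)//= addrAC subrr add0r.
rewrite -minv /push_additive (bigD1_seq i)//=.
rewrite (_ : T i @^-1` _ = set0); last first.
  by apply/seteqP; split=> // x; apply; left; apply: TK; exists x.
rewrite (additive_set0 mP) mulr0 add0r exprS -rest mulr_suml rest.
rewrite big_seq_cond [leRHS]big_seq_cond; apply: ler_sum => j /andP[sj _].
rewrite ler_wpM2l// (le_trans _ IH)// le_additive// => x /=.
apply: contra_not => Kx; right.
rewrite -(bigcup_seq s (fun k => T k @` word_compact n)).
by exists j => //; exists x.
Qed.

Lemma invariant_tight m : additive_probability m ->
  (forall A, push_additive s p T m A = m A) -> tight m.
Proof.
move=> mP minv e e0.
have p_le1 : p i <= 1 by rewrite -p_sum (bigD1_seq i)//= lerDl sumr_ge0.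
have : (1 - p i) ^+ n @[n --> \oo] --> 0.
  by apply: cvg_expr; rewrite ger0_norm ?subr_ge0// ltrBlDr ltrDl.
move=> /cvgrPdist_le/(_ _ e0)[n _ /(_ n (leqnn n))].
rewrite sub0r normrN ger0_norm ?exprn_ge0 ?subr_ge0// => ne.
exists (word_compact n); first exact: compact_word_compact.
exact: le_trans (additive_word_compactC n mP minv) ne.
Qed.

End tightness.

Local Open Scope ereal_scope.

(** * The Markov operator as a mixture of image measures *)

Section feller.
Context {R : realType} {G : completeMetricType R} {I : choiceType}.
Context {s : seq I} {p : I -> R} {T : I -> G -> G}.
Hypotheses (p_ge0 : forall j, (0 <= p j)%R) (p_sum : (\sum_(j <- s) p j = 1)%R).
Hypothesis contT : forall j, continuous (T j).

Lemma continuous_borel_measurable (f : G -> G) : continuous f ->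
  measurable_fun setT (f : borel G -> borel G).
Proof.
move=> cf.
apply: (@measurability _ _ (borel G) (borel G) setT f (@open G)) => //.
move=> _ [U oU <-].
by rewrite setTI; apply: open_borel; move/continuousP : cf; apply.
Qed.

Lemma mixture_probability (pi : probability (borel G) R) :
  exists nu : probability (borel G) R, forall A : set (borel G),
    nu A = \sum_(j <- s) (p j)%:E * pi (T j @^-1` A).
Proof.
have [nu nuE] : exists nu : {measure set (borel G) -> \bar R}, forall A,
    nu A = \sum_(j <- s) (p j)%:E * pi (T j @^-1` A).
  elim: s => [|j s' [nu nuE]]; first by exists mzero => A; rewrite big_nil.
  pose Tj : {mfun borel G >-> borel G} := HB.pack (T j : borel G -> borel G)
    (isMeasurableFun.Build _ _ _ _ (T j : borel G -> borel G)
      (continuous_borel_measurable (@contT j))).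
  exists (measure_add (mscale (NngNum (p_ge0 j)) (distribution pi Tj)) nu) => A.
  rewrite big_cons -nuE; exact: measure_addE.
have nuT : nu setT = 1.
  rewrite nuE; under eq_bigr do rewrite preimage_setT probability_setT mule1.
  by rewrite sumEFin p_sum.
have [nu' nu'E] := probability_of_measure nuT.
by exists nu' => A; rewrite nu'E.
Qed.

(** The comparison on open sets goes one way only: a closed subset of [U] pulls
back to a closed subset of each [T j @^-1` U], whereas closed subsets of the
latter need not come from [U]. *)
Lemma invariant_borel_probability m (pi : probability (borel G) R) :
  (forall A, push_additive s p T m A = m A) ->
  (forall U : set G, open U -> pi U = inner_content m U) ->
  forall A : set (borel G), measurable A ->
    \sum_(j <- s) (p j)%:E * pi (T j @^-1` A) = pi A.
Proof.
move=> minv piE A mA; have [nu nuE] := mixture_probability pi.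
rewrite -nuE; apply/esym; apply: eq_probability_open_le => // U oU.
rewrite piE// nuE; apply: inner_le => F cF FU.
rewrite -minv /push_additive -sumEFin; apply: lee_sum => j _.
have oTU : open (T j @^-1` U) by move/continuousP : (@contT j); apply.
rewrite EFinM lee_wpmul2l ?lee_fin// piE//; apply: le_inner_closed.
  by move/continuous_closedP : (@contT j); apply.
by move=> x /FU.
Qed.

End feller.

Section markov_operator.
Context {R : realType} {G : completeMetricType R}.
Context {dI : measure_display} {I : measurableType dI}.
Context {d : measure_display} {Omega : measurableType d}.
Context {P : probability Omega R} {xi : {RV P >-> I}} {T : I -> G -> G}.
Hypothesis discI : forall B : set I, measurable B.
Context {s : seq I}.
Hypotheses (us : uniq s) (sT : [set: I] = [set` s]).

Lemma law_finite_sum (B : set I) :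
  P (xi @^-1` B) = \sum_(j <- s) P (xi @^-1` [set j]) * (\1_B j)%:E.
Proof.
have mxi (C : set I) : measurable (xi @^-1` C).
  by rewrite -[X in measurable X]setTI; exact: measurable_funPT.
have -> : xi @^-1` B = \bigcup_(j in [set` s]) (xi @^-1` ([set j] `&` B)).
  rewrite -sT; apply/seteqP; split=> [w Bw|w [j _ [/= -> //]]].
  by exists (xi w).
rewrite measure_fin_bigcup//.
- rewrite -fsbig_seq//; apply: eq_bigr => j _; rewrite indicE.
  have [jB|jB] := boolP (j \in B).
    rewrite mule1; congr (P (xi @^-1` _)).
    by apply/seteqP; split=> [x []//|x -> ]; split=> //; exact: set_mem.
  rewrite mule0 (_ : _ `&` _ = set0) ?preimage_set0 ?measure0//.
  by apply/seteqP; split=> // x [-> /mem_set]; rewrite (negbTE jB).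
- exact: finite_seq.
- apply/trivIsetP => j k _ _ jk.
  apply/seteqP; split=> // w [[/= ->] _ [/= kj _]].
  by move: jk; rewrite kj eqxx.
Qed.

Lemma markov_operatorE (pi : probability (borel G) R) (A : set (borel G)) :
  (forall j, continuous (T j)) -> measurable A ->
  markov_operator T xi pi A =
    \sum_(j <- s) P (xi @^-1` [set j]) * pi (T j @^-1` A).
Proof.
move=> contT mA; rewrite /markov_operator.
have mTA j : measurable (T j @^-1` A : set (borel G)).
  rewrite -[X in measurable X]setTI.
  exact: continuous_borel_measurable.
have kE x : transition_kernel T xi x A =
    \sum_(j <- s) P (xi @^-1` [set j]) * (\1_(T j @^-1` A) x)%:E.
  exact: (law_finite_sum [set j | A (T j x)]).
under eq_integral do rewrite kE.
rewrite ge0_integral_sum//.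
- apply: eq_bigr => j _; rewrite ge0_integralZl//.
  - by rewrite integral_indic// setIT.
  - by apply/measurable_EFinP; exact: measurable_indic.
- move=> j; apply: emeasurable_funM => //.
  by apply/measurable_EFinP; exact: measurable_indic.
- by move=> j x _; rewrite mule_ge0// lee_fin.
Qed.

End markov_operator.

(** * Existence of an invariant measure *)

Theorem proposition3p2 (R : realType)
    (G : completeMetricType R) (sepG : separable G)
    (dI : measure_display) (I : measurableType dI)
    (finI : finite_set [set: I]) (discI : forall B : set I, measurable B)
    (T : I -> G -> G) (contT : forall j : I, continuous (T j))
    (d : measure_display) (Omega : measurableType d)
    (P : probability Omega R) (xi : {RV P >-> I})
    (i : I) (xi_i : 0 < P (xi @^-1` [set i]))
    (K : set G) (compactK : compact K) (TiK : range (T i) `<=` K) :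
  exists pi : probability (borel G) R, invariant_measure T xi pi.
Proof.
have [s0 s0T] := proj1 (finite_seqP _) finI; pose s := undup s0.
have us : uniq s := undup_uniq s0.
have sT : [set: I] = [set` s].
  by rewrite s0T; apply/seteqP; split=> x /=; rewrite mem_undup.
have si j : j \in s by have : [set: I] j by []; rewrite sT.
pose p j := fine (P (xi @^-1` [set j])).
have pE j : (p j)%:E = P (xi @^-1` [set j]).
  rewrite fineK// fin_num_measure// -[X in measurable X]setTI.
  exact: measurable_funPT.
have p_ge0 j : (0 <= p j)%R by rewrite fine_ge0.
have p_gt0 : (0 < p i)%R by rewrite -lte_fin pE.
have p_sum : (\sum_(j <- s) p j = 1)%R.
  apply: EFin_inj; rewrite -sumEFin -(probability_setT P).
  rewrite -(preimage_setT xi) (law_finite_sum discI us sT).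
  by apply: eq_bigr => j _; rewrite indicT mule1 pE.
have [m mP minv] := invariant_additive_probability T p_ge0 p_sum point.
have tm : tight m :=
  invariant_tight us p_ge0 p_sum contT (si i) p_gt0 compactK TiK mP minv.
have [pi piE] := borel_extension mP tm.
exists pi => A mA; rewrite (markov_operatorE discI us sT)//.
under eq_bigr do rewrite -pE.
exact (invariant_borel_probability p_ge0 p_sum contT minv piE mA).
Qed.
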